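(* Let $C=\mathbb{R}_+^*/\mu^{\mathbb{Z}}$ be a $\zeta$-cycle of length $L=\log\mu$ ($\mu>1$). Then for any positive integer $n>0$ the $n$-fold cover $C_n=\mathbb{R}_+^*/\mu^{n\mathbb{Z}}$ of $C$ (a circle of length $nL$) is a $\zeta$-cycle.
   Context: $\mathcal{S}_0^{\rm ev}$ is the linear space of (complex-valued) even Schwartz functions $f$ on $\mathbb{R}$ with $f(0)=0$ and $\int_{\mathbb{R}} f(x)\,dx=0$. For such $f$, $\mathcal{E}(f)(u):=u^{1/2}\sum_{n>0} f(nu)$ for $u\in\mathbb{R}_+^*=(0,\infty)$. For $\mu>1$ and a function $g$ on $\mathbb{R}_+^*$ decaying fast enough at $0$ and $\infty$, $(\Sigma_\mu g)(u):=\sum_{k\in\mathbb{Z}} g(\mu^k u)$, viewed as a function on $\mathbb{R}_+^*/\mu^{\mathbb{Z}}$; for $f\in\mathcal{S}_0^{\rm ev}$, $\Sigma_\mu\mathcal{E}(f)$ is well defined and bounded. A circle of length $L=\log\mu>0$ is identified with $C=\mathbb{R}_+^*/\mu^{\mathbb{Z}}$, endowed with the measure induced by $d^*u=du/u$, and $L^2(C)$ is the complex Hilbert space of square integrable functions. A $\zeta$-cycle is a circle $C$ of length $L=\log\mu$ such that the subspace $\Sigma_\mu\mathcal{E}(\mathcal{S}_0^{\rm ev})$ is not dense in $L^2(C)$. *)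

(* Defs.v *)
From mathcomp Require Import all_boot all_order all_algebra.
From mathcomp Require Import complex.
From mathcomp Require Import all_classical all_reals all_analysis.

Set Implicit Arguments.
Unset Strict Implicit.
Unset Printing Implicit Defensive.

Import Order.TTheory GRing.Theory Num.Theory.
Import numFieldNormedType.Exports.

Local Open Scope classical_set_scope.
Local Open Scope ring_scope.
Local Open Scope complex_scope.

Section ZetaCycles.
Context {R : realType}.

Definition real_schwartz (f : R -> R) : Prop :=
  (forall n x, derivable (derive1n n f) x 1) /\
  (forall k n, exists M, forall x, `|x ^+ k * derive1n n f x| <= M).

(* Differentiation, measurability and integration of complex-valued functions
   are taken componentwise, since the library only provides them for
   real-valued functions. *)
Definition schwartz (f : R -> R[i]) : Prop :=
  real_schwartz (fun x => complex.Re (f x)) /\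
  real_schwartz (fun x => complex.Im (f x)).

Definition cintegral (f : R -> R[i]) : R[i] :=
  (\int[lebesgue_measure]_x complex.Re (f x))
    +i* (\int[lebesgue_measure]_x complex.Im (f x)).

Definition S0ev : set (R -> R[i]) :=
  [set f | [/\ schwartz f, forall x, f (- x) = f x, f 0 = 0
             & cintegral f = 0]].

(* R[i]^o carries the topology of R[i] given by the complex modulus.
   Functions on the multiplicative group of positive reals are represented by
   functions on R whose values at u <= 0 are irrelevant. *)
Definition mapE (f : R -> R[i]) (u : R) : R[i] :=
  (Num.sqrt u)%:C * limn (series (fun n : nat => f (n.+1%:R * u) : R[i]^o)).

(* The sum of g (mu ^ k * u) over k in Z, split into its parts k >= 0 and k < 0. *)
Definition mapSigma (mu : R) (g : R -> R[i]) (u : R) : R[i] :=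
  limn (series (fun k : nat => g (mu ^+ k * u) : R[i]^o))
  + limn (series (fun k : nat => g (mu ^- k.+1 * u) : R[i]^o)).

(* Functions on the circle are the functions of u > 0 invariant under
   u |-> mu * u; the measure induced by du / u on the circle is computed on
   the fundamental domain [1, mu[. *)
Definition circle_sqnorm (mu : R) (h : R -> R[i]) : \bar R :=
  (\int[lebesgue_measure]_(u in `[1%R, mu[)
     (ComplexField.Normc.normc (h u) ^+ 2 / u)%:E)%E.

Definition circle_L2 (mu : R) : set (R -> R[i]) :=
  [set h : R -> R[i] | [/\ forall u : R, 0 < u -> h (mu * u) = h u,
      measurable_fun (`]0, +oo[ : set R) (fun x => complex.Re (h x)),
      measurable_fun (`]0, +oo[ : set R) (fun x => complex.Im (h x))
    & (circle_sqnorm mu h < +oo)%E]].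

Definition dense_in_circle_L2 (mu : R) (A : set (R -> R[i])) : Prop :=
  forall h, circle_L2 mu h -> forall eps : R, 0 < eps ->
    exists2 g, A g & (circle_sqnorm mu (g \- h)%R < (eps ^+ 2)%:E)%E.

Definition circle_length (mu : R) : R := ln mu.

Definition zeta_cycle (mu : R) : Prop :=
  1 < mu /\ ~ dense_in_circle_L2 mu [set mapSigma mu (mapE f) | f in S0ev].

End ZetaCycles.

(* Main.v *)
Require Import Defs.
From mathcomp Require Import all_boot all_order all_algebra.
From mathcomp Require Import complex zify ring lra.
From mathcomp Require Import all_classical all_reals all_analysis.
From mathcomp Require Import measurable_realfun.
Import Order.TTheory GRing.Theory Num.Theory.
Import numFieldNormedType.Exports.
Local Open Scope classical_set_scope.
Local Open Scope ring_scope.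

(** Write C for the circle of length log mu and C_n for its n-fold cover. The
    claim is proved by contraposition: if the image of S0ev is dense in L2(C_n),
    then it is dense in L2(C) (dense_image_cover).

    Summing a function on C_n over the n points of each fibre gives a function on
    C. This operator from L2(C_n) to L2(C) is bounded (circle_sqnorm_sum_le), and
    it is onto, because the pullback of h / n is sent to h. It also carries
    Sigma_(mu^n) E f to Sigma_mu E f, because Z is the disjoint union of the n
    residue classes modulo n (mapSigma_cover). A bounded surjection maps a dense
    subspace onto a dense subspace.

    Rearranging the sum over Z requires absolute convergence of the periodized
    sum of E f. At infinity it follows from the decay of f. Near 0 it follows from
    E f(u) = O(u^(1/2)): the sum of u f(k u) over k > 0 is a Riemann sum for the
    integral of f over the positive half-line. That integral vanishes because f is
    even with zero integral, and the error of the Riemann sum is O(u) because f'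
    decays like 1 / (1 + x^2) (riemann_sum_error, lattice_sum_small). Hence E f
    decays geometrically along the orbits of mu^Z (realE_orbit_bound).

    The boundedness of the summation operator is Cauchy-Schwarz on each fibre
    together with the invariance of du / u under scaling, which splits the
    integral over [1, mu^n[ into n integrals over [1, mu[ (integral_cover). Limits,
    derivatives and measurability are treated on real and imaginary parts. *)

(** * Series: residue classes and complex terms *)

Section Series.
Set Implicit Arguments.
Unset Strict Implicit.
Context {R : realType}.
Implicit Types (a b : R^nat) (z : nat -> R[i]).

Lemma is_cvg_series_le_geometric a (A q : R) : 0 <= q < 1 ->
  (forall k, `|a k| <= A * q ^+ k) -> cvgn (series a).
Proof.
move=> /andP[q0 q1] aA; apply: normed_cvg.
have A0 : 0 <= A by have := le_trans (normr_ge0 _) (aA 0); rewrite expr0 mulr1.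
apply: (@series_le_cvg _ _ (geometric A q)) => //=.
- by move=> k; rewrite mulr_ge0// exprn_ge0.
- by apply: is_cvg_geometric_series; rewrite ger0_norm.
Qed.

(** Geometric domination makes the sum over each residue class modulo n converge
    separately; the limits are then compared along the partial sums over the
    first K * n terms, where both sides coincide. *)
Lemma series_residues a (A q : R) (n : nat) : 0 <= q < 1 ->
  (forall k, `|a k| <= A * q ^+ k) -> (0 < n)%N ->
  \sum_(j < n) limn (series (fun k => a (k * n + j)%N)) = limn (series a).
Proof.
move=> q01 aA n0.
have /andP[q0 q1] := q01.
have A0 : 0 <= A by have := le_trans (normr_ge0 _) (aA 0); rewrite expr0 mulr1.
have ca : cvgn (series a) by exact: is_cvg_series_le_geometric aA.
have cj (j : nat) : cvgn (series (fun k => a (k * n + j)%N)).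
  apply: (is_cvg_series_le_geometric (A := A) q01) => k.
  apply: (le_trans (aA _)); apply: ler_wpM2l => //.
  rewrite ler_wiXn2l ?(ltW q1)//.
  by rewrite (leq_trans _ (leq_addr _ _))// leq_pmulr.
have := cvg_series_cvg_series_group ca n0.
rewrite [X in X @ _ --> _](_ : _ =
    (fun K => \sum_(j < n) series (fun k => a (k * n + j)%N) K)); last first.
  apply/funext => K; rewrite /series/= exchange_big/=; apply: eq_bigr => m _.
  rewrite -[(m * n)%N in LHS]add0n big_addn mulSn addnK big_mkord.
  by apply: eq_bigr => j _; rewrite addnC.
move=> h; apply: (cvg_unique _ _ h) => //.
by apply: cvg_big => [|j _]; [exact: add_continuous|exact: cj].
Qed.

Lemma sqrt_sqrD_le (p q : R) : Num.sqrt (p ^+ 2 + q ^+ 2) <= `|p| + `|q|.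
Proof.
rewrite -[leRHS]ger0_norm ?addr_ge0// -sqrtr_sqr ler_wsqrtr//.
rewrite sqrrD !real_normK ?num_real//.
by rewrite lerD2r lerDl mulrn_wge0// mulr_ge0.
Qed.

(** The topology of R[i]^o comes from a norm with values in R[i], so a
    neighbourhood radius is a complex number with zero imaginary part. *)
Lemma cvg_complex a b (x y : R) : a @ \oo --> x -> b @ \oo --> y ->
  (fun n => (a n +i* b n)%C : R[i]^o) @ \oo --> ((x +i* y)%C : R[i]^o).
Proof.
move=> ax bY; apply/cvgrPdist_lt => e.
rewrite ltcE/= => /andP[/eqP ei e0].
have e20 : 0 < complex.Re e / 2 by rewrite divr_gt0.
have /cvgrPdist_lt/(_ _ e20) Ha := ax.
have /cvgrPdist_lt/(_ _ e20) Hb := bY.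
near=> n.
have an : `|x - a n| < complex.Re e / 2 by near: n.
have bn : `|y - b n| < complex.Re e / 2 by near: n.
rewrite ltcE/= ei eqxx/=.
apply: (@le_lt_trans _ _ (`|x - a n| + `|y - b n|)); last by lra.
exact: sqrt_sqrD_le.
Unshelve. all: by end_near. Qed.

Lemma Re_sum I (r : seq I) (z : I -> R[i]) :
  complex.Re (\sum_(k <- r) z k) = \sum_(k <- r) complex.Re (z k).
Proof. by apply: big_morph => // -[? ?] [? ?]. Qed.

Lemma Im_sum I (r : seq I) (z : I -> R[i]) :
  complex.Im (\sum_(k <- r) z k) = \sum_(k <- r) complex.Im (z k).
Proof. by apply: big_morph => // -[? ?] [? ?]. Qed.

Lemma lim_series_complex z :
  cvgn (series (fun k => complex.Re (z k))) ->
  cvgn (series (fun k => complex.Im (z k))) ->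
  limn (series (fun k => z k : R[i]^o)) =
  (limn (series (fun k => complex.Re (z k)))
    +i* limn (series (fun k => complex.Im (z k))))%C.
Proof.
move=> cr ci; apply/cvg_lim; first exact: norm_hausdorff.
rewrite (_ : series _ = (fun n => (series (fun k => complex.Re (z k)) n
    +i* series (fun k => complex.Im (z k)) n)%C : R[i]^o)); last first.
  by apply/funext => n; rewrite /series/= -Re_sum -Im_sum;
    case: (\sum_(_ <= _ < _) _).
exact: cvg_complex.
Qed.

End Series.

(** * Even Schwartz functions and their antiderivatives *)

Section SchwartzDecay.
Set Implicit Arguments.
Unset Strict Implicit.
Context {R : realType}.
Implicit Types (g : R -> R).

(** The seminorms of exponents 0 and 2 add up to a decay rate which is both
    integrable over the line and summable over the multiples of any u > 0. *)
Lemma real_schwartz_decay g (n : nat) : real_schwartz g ->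
  exists M, forall x, `|derive1n n g x| <= M / (1 + x ^+ 2).
Proof.
move=> [_ gM]; have [M0 HM0] := gM 0%N n; have [M2 HM2] := gM 2%N n.
exists (M0 + M2) => x.
have x2 : 0 <= x ^+ 2 by exact: sqr_ge0.
rewrite ler_pdivlMr; last by rewrite ltr_wpDr.
rewrite mulrDr mulr1; apply: lerD; first by have := HM0 x; rewrite expr0 mul1r.
by have := HM2 x; rewrite normrM (ger0_norm x2) mulrC.
Qed.

Lemma real_schwartz_is_derive g : real_schwartz g ->
  forall x : R, is_derive x 1 g (derive1n 1 g x).
Proof.
move=> [dg _] x; apply: DeriveDef; first exact: (dg 0%N).
by rewrite derive1n1 derive1E.
Qed.

Lemma real_schwartz_continuous g : real_schwartz g -> continuous g.
Proof.
move=> [dg _] x; apply: differentiable_continuous.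
by apply/derivable1_diffP; exact: (dg 0%N).
Qed.

Lemma integrable_oneDsqrV (M : R) :
  lebesgue_measure.-integrable [set: R] (fun x => (M / oneDsqr x)%:E).
Proof.
have i1 : lebesgue_measure.-integrable [set: R] (fun x => (oneDsqr x)^-1%:E).
  apply/integrableP; split.
    apply/measurable_EFinP; apply: continuous_measurable_fun => x.
    exact: continuous_oneDsqrV.
  under eq_integral do rewrite gee0_abs ?lee_fin ?invr_ge0//.
  rewrite (@ge0_symfun_integralT _ (fun x => (oneDsqr x)^-1)).
  - by rewrite -set_itvcy integral0y_oneDsqr -EFinM ltry.
  - by move=> x; rewrite invr_ge0.
  - exact: continuous_oneDsqrV.
  - by move=> x; rewrite /= /oneDsqr sqrrN.
have := integrableZl measurableT M i1.
by apply: eq_integrable => // x _; rewrite EFinM.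
Qed.

Lemma real_schwartz_integrable g : real_schwartz g ->
  lebesgue_measure.-integrable [set: R] (EFin \o g).
Proof.
move=> sg; have [M gM] := real_schwartz_decay 0 sg.
apply: (le_integrable _ _ _ (integrable_oneDsqrV M)) => //.
  apply/measurable_EFinP; apply: continuous_measurable_fun.
  exact: real_schwartz_continuous.
by move=> x _ /=; rewrite lee_fin (le_trans (gM x))// ler_norm.
Qed.

(** The lower limit -oo makes this an antiderivative on the whole line whose
    limit at +oo is the full integral. *)
Definition antideriv g (x : R) : R := \int[lebesgue_measure]_(t in `]-oo, x]) g t.

Lemma antiderivP g : real_schwartz g ->
  forall x : R, is_derive x 1 (antideriv g) (g x).
Proof.
move=> sg x.
have [] := @continuous_FTC1 R g -oo%O x (x + 1) _ _ _ _.
- by rewrite ltrDl.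
- by apply: integrableS (real_schwartz_integrable sg).
- by rewrite ltNyr.
- exact: real_schwartz_continuous.
by move=> dF F'; apply: DeriveDef; [exact: dF|rewrite -derive1E; exact: F'].
Qed.

(** Dominated convergence for the restrictions of g to ]-oo, N u]; only the
    sequence of multiples of u is needed to compare with Riemann sums. *)
Lemma antideriv_cvg g (u : R) : real_schwartz g -> 0 < u ->
  \int[lebesgue_measure]_x g x = 0 ->
  (fun N : nat => antideriv g (N%:R * u)) @ \oo --> 0.
Proof.
move=> sg u0 g0.
have ig := real_schwartz_integrable sg.
have mg : measurable_fun [set: R] (EFin \o g) by case/integrableP : ig.
pose D (N : nat) : set R := [set` `]-oo, N%:R * u]].
have := @dominated_convergence _ _ _ lebesgue_measure _ measurableT
  (fun N => (EFin \o g) \_ (D N)) (EFin \o g) (fun x => `|(g x)%:E|%E).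
case.
- move=> N; apply/(measurable_restrictT _ _).1.
    exact: measurable_itv.
  exact: measurable_funTS.
- exact: mg.
- apply: aeW => x _; apply: cvg_near_cst; near=> N.
  rewrite /patch mem_set// /D/= in_itv/= -ler_pdivrMr//.
  by near: N; exact: nbhs_infty_ger.
- exact: integrable_abse.
- apply: aeW => x N _; rewrite /patch; case: ifPn => // _.
  by rewrite abse0.
move=> _ _ cF.
rewrite -g0 /Rintegral; apply: fine_cvg.
rewrite fineK; last exact: integrable_fin_num.
by under eq_fun do rewrite integral_mkcond.
Unshelve. all: by end_near. Qed.

(** By the symmetry of g and of the Lebesgue measure under x |-> - x, each
    half-line carries half of the integral. *)
Lemma antideriv0 g : real_schwartz g -> (forall x, g (- x) = g x) ->
  \int[lebesgue_measure]_x g x = 0 -> antideriv g 0 = 0.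
Proof.
move=> sg evg.
have ig := real_schwartz_integrable sg.
have mg : measurable_fun [set: R] (EFin \o g) by case/integrableP : ig.
have half : (\int[lebesgue_measure]_(x in `[0%R, +oo[) (g x)%:E =
             \int[lebesgue_measure]_(x in `]-oo, 0%R]) (g x)%:E)%E.
  rewrite (_ : `]-oo, 0%R]%classic =
      (-%R : _ -> measurableTypeR R) @^-1` `[0%R, +oo[); last first.
    by rewrite opp_preimage_itvbndy oppr0.
  transitivity (\int[pushforward lebesgue_measure
      (-%R : measurableTypeR R -> measurableTypeR R)]_(x in `[0%R, +oo[)
        (g x)%:E)%E.
    apply: eq_measure_integral => //= A mA AS; exact/esym/lebesgue_measureN.
  rewrite integral_pushforward//.
  - by apply: eq_integral => x _ /=; rewrite evg.
  - rewrite opp_preimage_itvbndy oppr0.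
    have : lebesgue_measure.-integrable `]-oo, 0%R] (EFin \o g).
      by apply: integrableS ig.
    by apply: eq_integrable => // x _ /=; rewrite evg.
have -> : \int[lebesgue_measure]_x g x =
    \int[lebesgue_measure]_(x in `]-oo, 0%R] `|` ~` `]-oo, 0%R]) g x.
  by rewrite setUv.
rewrite Rintegral_setU//; last 3 first.
- exact: measurableC.
- by rewrite setUv.
- exact/disj_setPCl.
rewrite setCitvl Rintegral_itv_obnd_cbnd; last first.
  by apply: integrableS ig.
have -> : \int[lebesgue_measure]_(x in `[0, +oo[) g x = antideriv g 0.
  by rewrite /Rintegral half.
by move=> /eqP; rewrite -mulr2n mulrn_eq0/= => /eqP.
Qed.

End SchwartzDecay.

(** * Bounds for the sum of a function over the positive multiples of u *)

Section LatticeSum.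
Set Implicit Arguments.
Unset Strict Implicit.
Context {R : realType}.
Implicit Types (g : R -> R).

Lemma series_abs_bounded (a : R^nat) (B : R) :
  (forall N, \sum_(0 <= k < N) `|a k| <= B) ->
  cvgn (series a) /\ `|limn (series a)| <= B.
Proof.
move=> aB.
have ca : cvgn [normed series a].
  apply: nondecreasing_is_cvgn.
    by apply: nondecreasing_series => k _ _; exact: normr_ge0.
  by exists B => _ [N _ <-]; exact: aB.
split; first exact: normed_cvg.
apply: (le_trans (lim_series_norm ca)); apply: limr_le => //.
by apply: nearW => N; exact: aB.
Qed.

(** Comparison with the telescoping series of 2 / (k (k + 1)). *)
Lemma sum_inv_sqr_le2 (N : nat) : \sum_(0 <= k < N) (k.+1%:R ^+ 2)^-1 <= 2 :> R.
Proof.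
suff : \sum_(0 <= k < N) (k.+1%:R ^+ 2)^-1 <= 2 - 2 / N.+1%:R :> R.
  by move=> /le_trans; apply; rewrite gerBl.
elim: N => [|N IH]; first by rewrite big_nil divr1 subrr.
rewrite big_nat_recr//=; apply: (le_trans (lerD IH (lexx _))).
have a0 : 0 < N.+1%:R :> R by [].
have -> : N.+2%:R = N.+1%:R + 1 :> R by rewrite -natr1.
set x : R := N.+1%:R in a0 *.
have x1 : 0 < x + 1 by rewrite addr_gt0.
have x2 : 1 <= x by rewrite /x ler1n.
have E : 2 / x - 2 / (x + 1) - (x ^+ 2)^-1 = (x - 1) / (x ^+ 2 * (x + 1)).
  by field; rewrite !gt_eqF.
have : 0 <= (x - 1) / (x ^+ 2 * (x + 1)).
  by rewrite divr_ge0 ?subr_ge0// mulr_ge0// ?sqr_ge0// ltW.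
by rewrite -E; move: (2 / x) (2 / (x + 1)) ((x ^+ 2)^-1) => p q r; lra.
Qed.

(** The bound used for large v. *)
Lemma lattice_sum_decay g (M v : R) : (forall x, `|g x| <= M / (1 + x ^+ 2)) ->
  0 < v ->
  cvgn (series (fun n => g (n.+1%:R * v))) /\
  `|limn (series (fun n => g (n.+1%:R * v)))| <= 2 * M / v ^+ 2.
Proof.
move=> gM v0; apply: series_abs_bounded => N.
have M0 : 0 <= M.
  by have := le_trans (normr_ge0 _) (gM 0); rewrite expr0n addr0 divr1.
apply: (@le_trans _ _ (\sum_(0 <= k < N) (M / v ^+ 2) * (k.+1%:R ^+ 2)^-1)).
  apply: ler_sum_nat => k _; apply: (le_trans (gM _)).
  rewrite -mulrA ler_wpM2l// -invfM lef_pV2 ?posrE; last 2 first.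
  - by rewrite ltr_wpDr// sqr_ge0.
  - by rewrite mulr_gt0// exprn_gt0.
  by rewrite exprMn mulrC lerDr.
rewrite -mulr_sumr mulrAC mulrC mulrA [2 * M]mulrC mulrAC -mulrA.
rewrite mulrC [leRHS]mulrC ler_wpM2l ?invr_ge0 ?sqr_ge0//.
by rewrite ler_wpM2r// sum_inv_sqr_le2.
Qed.

(** Error of the right-endpoint rule on one interval of length v. The mean value
    theorem applied to F x - F a - (x - a) g x bounds it by v ^ 2 times the size of
    g' on the interval; the bound is then put in telescoping form, which is
    possible because 1 + a and 1 + (a + v) are comparable when v <= 1. *)
Lemma riemann_step (F g g' : R -> R) (M a v : R) :
  (forall x : R, is_derive x 1 F (g x)) -> (forall x : R, is_derive x 1 g (g' x)) ->
  (forall x, `|g' x| <= M / (1 + x ^+ 2)) -> 0 <= a -> 0 < v -> v <= 1 ->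
  `|v * g (a + v) - (F (a + v) - F a)| <=
    4 * M * v * ((1 + a)^-1 - (1 + (a + v))^-1).
Proof.
move=> dF dg gM a0 v0 v1.
(* P a = 0, P (a + v) is minus the error, and P' x = - (x - a) g' x. *)
pose P := fun x => F x - F a - (x - a) * g x.
have dP (x : R) : is_derive x 1 P (- ((x - a) * g' x)).
  apply: is_derive_eq; rewrite /GRing.scale/=; ring.
have cP : {within `[a, a + v], continuous P}.
  apply: continuous_subspaceT => x; apply: differentiable_continuous.
  by apply/derivable1_diffP; exact: ex_derive.
have av : a < a + v by rewrite ltrDl.
have [c] := MVT av (fun x _ => dP x) cP.
rewrite in_itv/= => /andP[ac cv] E.
have {E} -> : v * g (a + v) - (F (a + v) - F a) = v * ((c - a) * g' c).
  move: E; rewrite /P !subrr mul0r !subr0 [a + v]addrC addrK => E.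
  have {E} : F (v + a) - F a - v * g (v + a) = - ((c - a) * g' c) * v by lra.
  by move=> E; rewrite -[LHS]opprK -[RHS]opprK; congr (- _); lra.
have M0 : 0 <= M.
  by have := le_trans (normr_ge0 _) (gM 0); rewrite expr0n addr0 divr1.
have c21 : 0 < 1 + c ^+ 2 by rewrite ltr_wpDr// sqr_ge0.
have a1 : 0 < 1 + a by lra.
have av1 : 0 < 1 + (a + v) by lra.
have -> : (1 + a)^-1 - (1 + (a + v))^-1 = v / ((1 + a) * (1 + (a + v))).
  by field; rewrite !gt_eqF.
rewrite normrM (gtr0_norm v0) normrM (gtr0_norm (_ : 0 < c - a)) ?subr_gt0//.
rewrite [4 * M * v]mulrC -mulrA ler_pM2l//.
apply: (@le_trans _ _ (v * (M / (1 + c ^+ 2)))).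
  by apply: ler_pM => //; [rewrite subr_ge0 ltW|lra].
rewrite [leRHS]mulrCA ler_pM2l// [4 * M]mulrC -mulrA ler_wpM2l//.
rewrite ler_pdivlMr ?mulr_gt0// mulrC ler_pdivrMr//.
have : (1 + a) * (1 + (a + v)) <= (1 + c) * (2 + c).
  by apply: ler_pM; lra.
by nra.
Qed.

(** Summing the telescoping one-step errors gives O(v), uniformly in the number
    of terms. *)
Lemma riemann_sum_error (F g g' : R -> R) (M v : R) (N : nat) :
  (forall x : R, is_derive x 1 F (g x)) -> (forall x : R, is_derive x 1 g (g' x)) ->
  (forall x, `|g' x| <= M / (1 + x ^+ 2)) -> F 0 = 0 -> 0 < v -> v <= 1 ->
  `|v * \sum_(0 <= k < N) g (k.+1%:R * v) - F (N%:R * v)| <= 4 * M * v.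
Proof.
move=> dF dg gM F0 v0 v1.
have M0 : 0 <= M.
  by have := le_trans (normr_ge0 _) (gM 0); rewrite expr0n addr0 divr1.
suff : `|v * \sum_(0 <= k < N) g (k.+1%:R * v) - F (N%:R * v)| <=
    4 * M * v * (1 - (1 + N%:R * v)^-1).
  move=> /le_trans; apply; rewrite ler_piMr ?mulr_ge0 ?(ltW v0)//.
  by rewrite gerBl invr_ge0 addr_ge0// mulr_ge0// ltW.
elim: N => [|N IH].
  by rewrite big_nil mul0r F0 mulr0 !addr0 invr1 !subrr mulr0 normr0.
have Nv : 0 <= N%:R * v by rewrite mulr_ge0// ltW.
have := lerD IH (riemann_step dF dg gM Nv v0 v1).
have -> : N%:R * v + v = N.+1%:R * v by rewrite -natr1 mulrDl mul1r.
rewrite -mulrDr addrA subrK; apply: le_trans.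
apply: le_trans (ler_normD _ _); rewrite big_nat_recr//= mulrDr.
by rewrite le_eqVlt; apply/orP; left; apply/eqP; congr `|_|; ring.
Qed.

(** Here the vanishing of the integral enters: v times the lattice sum is a
    Riemann sum for the integral of g over the positive half-line, which is 0, so
    the lattice sum itself stays bounded as v tends to 0. *)
Lemma lattice_sum_small g g' (M M' v : R) : real_schwartz g ->
  (forall x, g (- x) = g x) -> \int[lebesgue_measure]_x g x = 0 ->
  (forall x : R, is_derive x 1 g (g' x)) ->
  (forall x, `|g x| <= M / (1 + x ^+ 2)) ->
  (forall x, `|g' x| <= M' / (1 + x ^+ 2)) ->
  0 < v -> v <= 1 ->
  `|limn (series (fun n => g (n.+1%:R * v)))| <= 4 * M'.
Proof.
move=> sg evg g0 dg gM gM' v0 v1.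
have [cS _] := lattice_sum_decay gM v0.
have cF := antideriv_cvg sg v0 g0.
have err N := riemann_sum_error N (antiderivP sg) dg gM'
  (antideriv0 sg evg g0) v0 v1.
have cE : (fun N : nat => `|v * series (fun n => g (n.+1%:R * v)) N -
    antideriv g (N%:R * v)|) @ \oo -->
    `|v * limn (series (fun n => g (n.+1%:R * v))) - 0|.
  by apply: cvg_norm; apply: cvgB => //; apply: cvgMr.
rewrite -(ler_pM2l v0) -[X in X * `|_|](gtr0_norm v0) -normrM [leRHS]mulrC.
rewrite -[X in `|X|]subr0 -(cvg_lim _ cE)//; apply: limr_le.
  by apply/cvg_ex; eexists; exact: cE.
exact: nearW.
Qed.

End LatticeSum.

(** * The map E, the periodization and covers *)

Section Maps.
Set Implicit Arguments.
Unset Strict Implicit.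
Context {R : realType}.
Implicit Types (g : R -> R) (f : R -> R[i]).

Definition even_schwartz_int0 g : Prop :=
  [/\ real_schwartz g, forall x, g (- x) = g x
    & \int[lebesgue_measure]_x g x = 0].

Definition realE g (u : R) : R :=
  Num.sqrt u * limn (series (fun n => g (n.+1%:R * u))).

Definition realSigma (mu : R) g (u : R) : R :=
  limn (series (fun k => g (mu ^+ k * u)))
  + limn (series (fun k => g (mu ^- k.+1 * u))).

Lemma S0ev_Re f : S0ev f -> even_schwartz_int0 (fun x => complex.Re (f x)).
Proof.
move=> [[sr si] evf f0 [fr fi]]; split => // x.
by rewrite evf.
Qed.

Lemma S0ev_Im f : S0ev f -> even_schwartz_int0 (fun x => complex.Im (f x)).
Proof.
move=> [[sr si] evf f0 [fr fi]]; split => // x.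
by rewrite evf.
Qed.

(** Since the square root of a nonpositive number is 0, realE g is controlled on
    the whole line, so that measurability holds on all of R. *)
Lemma realE_le0 g (u : R) : u <= 0 -> realE g u = 0.
Proof. by move=> u0; rewrite /realE ler0_sqrtr// mul0r. Qed.

Lemma is_cvg_lattice_sum g (u : R) : even_schwartz_int0 g -> 0 < u ->
  cvgn (series (fun n => g (n.+1%:R * u))).
Proof.
move=> [sg _ _] u0; have [M gM] := real_schwartz_decay 0 sg.
exact: (lattice_sum_decay gM u0).1.
Qed.

(** The first bound matters near 0 and the second near infinity. *)
Lemma realE_bound g : even_schwartz_int0 g -> exists C, forall u, 0 < u ->
  `|realE g u| <= C * Num.sqrt u /\ `|realE g u| <= C * Num.sqrt u / u ^+ 2.
Proof.
move=> [sg evg g0].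
have [M gM] := real_schwartz_decay 0 sg.
have [M' gM'] := real_schwartz_decay 1 sg.
have M0 : 0 <= M.
  by have := le_trans (normr_ge0 _) (gM 0); rewrite expr0n addr0 divr1.
have M'0 : 0 <= M'.
  by have := le_trans (normr_ge0 _) (gM' 0); rewrite expr0n addr0 divr1.
exists (2 * M + 4 * M') => u u0.
have [_ Su] := lattice_sum_decay gM u0.
rewrite /realE normrM (ger0_norm (sqrtr_ge0 u)).
have u2 : 0 < u ^+ 2 by rewrite exprn_gt0.
split; last first.
  rewrite mulrC mulrAC ler_wpM2r ?sqrtr_ge0//; apply: (le_trans Su).
  by rewrite ler_wpM2r ?invr_ge0 ?(ltW u2)// lerDl mulr_ge0.
rewrite mulrC ler_wpM2r ?sqrtr_ge0//; have [u1|u1] := leP u 1.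
  have dg := real_schwartz_is_derive sg.
  apply: (le_trans (lattice_sum_small sg evg g0 dg gM gM' u0 u1)).
  by rewrite lerDr mulr_ge0.
apply: (le_trans Su); apply: (@le_trans _ _ (2 * M)).
  rewrite ler_pdivrMr// ler_peMr ?mulr_ge0//.
  by rewrite exprn_ege1// ltW.
by rewrite lerDl mulr_ge0.
Qed.

(** Along the orbit of u under mu ^ Z, realE g decays geometrically in both
    directions. The ratio 1 / sqrt mu is imposed by the bound C * sqrt u near 0;
    the bound near infinity gives the better ratio (1 / sqrt mu) ^ 3. *)
Lemma realE_orbit_bound g (mu u : R) : even_schwartz_int0 g -> 1 < mu ->
  exists A, forall k,
    `|realE g (mu ^+ k * u)| <= A * (Num.sqrt mu)^-1 ^+ k /\
    `|realE g (mu ^- k.+1 * u)| <= A * (Num.sqrt mu)^-1 ^+ k.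
Proof.
move=> Sg mu1; have mu0 : 0 < mu by rewrite (lt_trans _ mu1).
have [u0|u0] := leP u 0.
  exists 0 => k; rewrite mul0r.
  by split; rewrite realE_le0 ?normr0// mulr_ge0_le0// ?invr_ge0 exprn_ge0// ltW.
have [C CE] := realE_bound Sg.
set s := Num.sqrt mu.
have s1 : 1 < s by rewrite -sqrtr1 ltr_sqrt.
have s0 : 0 < s by rewrite (lt_trans _ s1).
have mus : mu = s ^+ 2 by rewrite sqr_sqrtr// ltW.
have su0 : 0 < Num.sqrt u by rewrite sqrtr_gt0.
have C0 : 0 <= C.
  have /le_trans/(_ (CE u u0).1) := normr_ge0 (realE g u).
  by rewrite pmulr_lge0.
have u20 : 0 < u ^+ 2 by rewrite exprn_gt0.
have sqrtX k : Num.sqrt (mu ^+ k) = s ^+ k.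
  by rewrite mus -exprM mulnC exprM sqrtr_sqr ger0_norm// exprn_ge0// ltW.
exists (C * Num.sqrt u / u ^+ 2 + C * Num.sqrt u) => k.
have A1 : 0 <= C * Num.sqrt u / u ^+ 2.
  by rewrite divr_ge0 ?mulr_ge0 ?sqrtr_ge0// ltW.
have A2 : 0 <= C * Num.sqrt u by rewrite mulr_ge0// ltW.
have sk0 : 0 < s ^+ k by rewrite exprn_gt0.
have sk1 : 1 <= s ^+ k by rewrite exprn_ege1// ltW.
have sV0 : 0 <= s^-1 ^+ k by rewrite exprn_ge0// invr_ge0 ltW.
split.
  have v0 : 0 < mu ^+ k * u by rewrite mulr_gt0// exprn_gt0.
  apply: (le_trans (CE _ v0).2).
  apply: (@le_trans _ _ (C * Num.sqrt u / u ^+ 2 * s^-1 ^+ k)); last first.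
    by rewrite ler_wpM2r// lerDl.
  rewrite sqrtrM ?exprn_ge0 ?(ltW mu0)// sqrtX exprMn mus exprVn -!exprM.
  have -> : C * (s ^+ k * Num.sqrt u) / (s ^+ (2 * (k * 2)) * u ^+ 2) =
     C * Num.sqrt u / u ^+ 2 * (s ^+ k / s ^+ (2 * (k * 2))).
    by field; rewrite !gt_eqF// exprn_gt0.
  rewrite ler_wpM2l// ler_pdivrMr ?exprn_gt0// -[leRHS]mulrC ler_pdivlMr//.
  rewrite -exprD ler_weXn2l ?(ltW s1)//.
  by clear; lia.
have v0 : 0 < mu ^- k.+1 * u by rewrite mulr_gt0// invr_gt0 exprn_gt0.
apply: (le_trans (CE _ v0).1).
apply: (@le_trans _ _ (C * Num.sqrt u * s^-1 ^+ k)); last first.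
  by rewrite ler_wpM2r// lerDr.
rewrite sqrtrM ?invr_ge0 ?exprn_ge0 ?(ltW mu0)// sqrtrV ?exprn_ge0 ?(ltW mu0)//.
rewrite sqrtX mulrCA mulrC ler_wpM2l// exprVn lef_pV2 ?posrE ?exprn_gt0//.
by rewrite ler_weXn2l// ltW.
Qed.

Lemma sqrtV_itv (mu : R) : 1 < mu -> 0 <= (Num.sqrt mu)^-1 < 1.
Proof.
move=> mu1; rewrite invr_ge0 sqrtr_ge0/= invf_lt1 ?sqrtr_gt0 ?(lt_trans _ mu1)//.
by rewrite -sqrtr1 ltr_sqrt// (lt_trans _ mu1).
Qed.

Lemma is_cvg_realE_orbit g (mu u : R) : even_schwartz_int0 g -> 1 < mu ->
  cvgn (series (fun k => realE g (mu ^+ k * u))) /\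
  cvgn (series (fun k => realE g (mu ^- k.+1 * u))).
Proof.
move=> Sg mu1; have [A EA] := realE_orbit_bound u Sg mu1.
by split; apply: is_cvg_series_le_geometric (sqrtV_itv mu1) _ => k;
  [exact: (EA k).1|exact: (EA k).2].
Qed.

(** The integers split into residue classes modulo n. In the half k < 0 the
    exponent of mu is j - n (k + 1) = - (k n + (n - 1 - j) + 1), hence the
    reversal of j there. *)
Lemma realSigma_cover g (mu u : R) (n : nat) : even_schwartz_int0 g -> 1 < mu ->
  (0 < n)%N ->
  \sum_(j < n) realSigma (mu ^+ n) (realE g) (mu ^+ j * u) =
  realSigma mu (realE g) u.
Proof.
move=> Sg mu1 n0; have [A EA] := realE_orbit_bound u Sg mu1.
have mu0 : mu != 0 by rewrite gt_eqF// (lt_trans _ mu1).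
rewrite /realSigma big_split/=; congr (_ + _).
  rewrite -(series_residues (sqrtV_itv mu1) (fun k => (EA k).1) n0).
  apply: eq_bigr => j _; congr (limn (series _)); apply/funext => k.
  by rewrite mulrA -exprM -exprD mulnC.
rewrite -(series_residues (sqrtV_itv mu1) (fun k => (EA k).2) n0).
rewrite [RHS](reindex_inj rev_ord_inj)/=.
apply: eq_bigr => j _; congr (limn (series _)); apply/funext => k.
congr (realE g _); rewrite mulrA; congr (_ * u).
have -> : (k * n + (n - j.+1)).+1 = (n * k.+1 - j)%N by have := ltn_ord j; nia.
rewrite -exprM -[in RHS]exprVn expfB_cond.
  by rewrite !exprVn invrK.
by rewrite invr_eq0 (negPf mu0); have := ltn_ord j; nia.
Qed.

Lemma measurable_realE g : even_schwartz_int0 g -> measurable_fun [set: R] (realE g).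
Proof.
move=> Sg; have [sg _ _] := Sg.
have := @measurable_fun_cvg _ _ R [set: R]
  (fun N u => Num.sqrt u * series (fun n => g (n.+1%:R * u)) N) (realE g).
apply=> [N|u _].
  apply: measurable_funM.
    by apply: continuous_measurable_fun; exact: sqrt_continuous.
  apply: measurable_sum => k; apply: (measurableT_comp (f := g)).
    by apply: continuous_measurable_fun; exact: real_schwartz_continuous.
  exact: mulrl_measurable.
have [u0|u0] := leP u 0.
  rewrite realE_le0// ler0_sqrtr//; under eq_fun do rewrite mul0r.
  exact: cvg_cst.
by apply: cvgMr; exact: is_cvg_lattice_sum.
Qed.

Lemma measurable_realSigma g (mu : R) : even_schwartz_int0 g -> 1 < mu ->
  measurable_fun [set: R] (realSigma mu (realE g)).
Proof.
move=> Sg mu1; have mE := measurable_realE Sg.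
have mlim (c : nat -> R) : (forall u, cvgn (series (fun k => realE g (c k * u)))) ->
    measurable_fun [set: R] (fun u => limn (series (fun k => realE g (c k * u)))).
  move=> cc; have := @measurable_fun_cvg _ _ R [set: R]
    (fun N u => series (fun k => realE g (c k * u)) N)
    (fun u => limn (series (fun k => realE g (c k * u)))).
  apply=> [N|u _]; last exact: cc.
  apply: measurable_sum => k; apply: (measurableT_comp mE).
  exact: mulrl_measurable.
apply: measurable_funD; apply: mlim => u.
- exact: (is_cvg_realE_orbit u Sg mu1).1.
- exact: (is_cvg_realE_orbit u Sg mu1).2.
Qed.

Lemma mapE_complex f (u : R) : S0ev f ->
  mapE f u = (realE (fun x => complex.Re (f x)) u
               +i* realE (fun x => complex.Im (f x)) u)%C.
Proof.
move=> Sf; rewrite /mapE; have [u0|u0] := leP u 0.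
  by rewrite !realE_le0// ler0_sqrtr// mul0r.
rewrite lim_series_complex.
- by rewrite /realE; simpc.
- exact: is_cvg_lattice_sum (S0ev_Re Sf) u0.
- exact: is_cvg_lattice_sum (S0ev_Im Sf) u0.
Qed.

Lemma mapSigma_complex f (mu u : R) : S0ev f -> 1 < mu ->
  mapSigma mu (mapE f) u =
  (realSigma mu (realE (fun x => complex.Re (f x))) u
    +i* realSigma mu (realE (fun x => complex.Im (f x))) u)%C.
Proof.
move=> Sf mu1; rewrite /mapSigma.
have [r1 r2] := is_cvg_realE_orbit u (S0ev_Re Sf) mu1.
have [i1 i2] := is_cvg_realE_orbit u (S0ev_Im Sf) mu1.
have E v := mapE_complex v Sf.
under [X in limn (series X) + _]eq_fun do rewrite E.
under [X in _ + limn (series X)]eq_fun do rewrite E.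
by rewrite !lim_series_complex.
Qed.

(** Periodizing over mu ^ Z amounts to periodizing over the subgroup mu ^ (n Z),
    then summing over the deck transformations of the n-fold cover. *)
Lemma mapSigma_cover f (mu u : R) (n : nat) : S0ev f -> 1 < mu -> (0 < n)%N ->
  \sum_(j < n) mapSigma (mu ^+ n) (mapE f) (mu ^+ j * u) =
  mapSigma mu (mapE f) u.
Proof.
move=> Sf mu1 n0; have mun1 : 1 < mu ^+ n by rewrite exprn_egt1// -lt0n.
rewrite mapSigma_complex//.
rewrite -(realSigma_cover u (S0ev_Re Sf) mu1 n0).
rewrite -(realSigma_cover u (S0ev_Im Sf) mu1 n0).
under eq_bigr do rewrite mapSigma_complex//.
apply: (big_ind3 (fun z (x y : R) => z = (x +i* y)%C)) => //.
by move=> _ a b _ c d -> ->.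
Qed.

End Maps.

(** * Scale invariance of du / u *)

Section Circle.
Set Implicit Arguments.
Unset Strict Implicit.
Context {R : realType}.
Implicit Types (phi : R -> R) (h : R -> R[i]).

Notation mu := lebesgue_measure.

Lemma measurable_scale (c : R) :
  measurable_fun [set: measurableTypeR R]
    ( *%R c : measurableTypeR R -> measurableTypeR R).
Proof. by apply: continuous_measurable_fun; exact: mulrl_continuous. Qed.

(** The measure structure is given explicitly, since the measurability of the map
    is one of its arguments. *)
Let image_by_scale (c : R) : {measure set (measurableTypeR R) -> \bar R} :=
  measure_function_pushforward__canonical__measure_function_Measure mu
    (@measurable_scale c).

(** Both measures give ]a, b] the mass b - a. *)
Lemma lebesgue_measureZ (c : R) (c0 : 0 < c) (A : set (measurableTypeR R)) :
  measurable A ->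
  mu A = mscale (NngNum (ltW c0)) (image_by_scale c) A.
Proof.
apply: lebesgue_measure_unique => _ [[a b]] _ <-.
rewrite -[RHS]/(c%:E * mu ( *%R c @^-1` [set` `]a, b]]))%E.
rewrite (_ : *%R c @^-1` [set` `]a, b]] = [set` `]a / c, b / c]]); last first.
  apply/seteqP; split => x /=; rewrite !in_itv/=.
    by rewrite ltr_pdivrMr// ler_pdivlMr// mulrC.
  by rewrite ltr_pdivrMr// ler_pdivlMr// mulrC.
rewrite !lebesgue_measure_itv/= !lte_fin ltr_pM2r ?invr_gt0//.
case: ifPn => _; last by rewrite mule0.
by rewrite -!EFinD -EFinM; congr EFin; field; rewrite gt_eqF.
Qed.

Lemma measurable_haar phi : measurable_fun (`]0, +oo[ : set R) phi ->
  measurable_fun (`]0, +oo[ : set R) (fun u => (phi u / u)%:E).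
Proof.
move=> mphi; apply/measurable_EFinP; apply: measurable_funM => //.
apply: open_continuous_measurable_fun => //.
move=> x /set_mem/=; rewrite in_itv/= andbT => x0.
by apply: inv_continuous; rewrite gt_eqF.
Qed.

Lemma integral_scale (c a b : R) phi : 0 < c -> 0 < a ->
  measurable_fun (`]0, +oo[ : set R) phi -> (forall u, 0 <= phi u) ->
  (\int[mu]_(u in `[(c * a)%R, (c * b)%R[) (phi u / u)%:E =
   \int[mu]_(u in `[a, b[) (phi (c * u)%R / u)%:E)%E.
Proof.
move=> c0 a0 mphi phi0.
pose D : set (measurableTypeR R) := [set` `[(c * a)%R, (c * b)%R[].
have D0 u : D u -> 0 < u.
  by rewrite /D/= in_itv/= => /andP[+ _]; apply: lt_le_trans; exact: mulr_gt0.
transitivity (\int[mscale (NngNum (ltW c0)) (image_by_scale c)]_(u in D)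
   (phi u / u)%:E)%E.
  by apply: eq_measure_integral => A mA _; exact: lebesgue_measureZ.
have mD : measurable D by exact: measurable_itv.
have mpsi : measurable_fun D (fun u => (phi u / u)%:E).
  apply: measurable_funS (measurable_haar mphi) => // u /D0 u0.
  by rewrite /= in_itv/= u0.
have psi0 u : D u -> (0 <= (phi u / u)%:E)%E.
  by move=> /D0 u0; rewrite lee_fin divr_ge0// ltW.
rewrite ge0_integral_mscale//= ge0_integral_pushforward//; last first.
  by move=> u /set_mem; exact: psi0.
have DE : *%R c @^-1` D = [set` `[a, b[].
  by apply/seteqP; split => x /=; rewrite /D/= !in_itv/= ler_pM2l// ltr_pM2l//.
have Dc u : [set` `[a, b[] u -> D (c * u) by rewrite -DE.
rewrite DE -ge0_integralZl//.
- apply: eq_integral => u _ /=; rewrite -EFinM; congr EFin.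
  by rewrite invfM mulrCA mulVKf ?gt_eqF.
- apply: (measurable_comp mD _ mpsi); last first.
    by apply: measurable_funTS; exact: measurable_scale.
  by move=> _ [u /Dc ? <-].
- by move=> u /Dc; exact: psi0.
- by rewrite lee_fin ltW.
Qed.

Lemma measurable_fun_scale (c : R) phi : 0 < c ->
  measurable_fun (`]0, +oo[ : set R) phi ->
  measurable_fun (`]0, +oo[ : set R) (fun u => phi (c * u)).
Proof.
move=> c0 mphi; apply: (measurable_comp _ _ mphi) => //.
by move=> _ [u /= + <-]; rewrite !in_itv/= !andbT => u0; rewrite mulr_gt0.
Qed.

(** [1, q ^ n[ is cut into the n translates [q ^ j, q ^ (j + 1)[ of the
    fundamental domain [1, q[, and du / u is invariant under scaling. *)
Lemma integral_cover (q : R) (n : nat) phi : 1 < q ->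
  measurable_fun (`]0, +oo[ : set R) phi -> (forall u, 0 <= phi u) ->
  (\int[mu]_(u in `[1%R, (q ^+ n)%R[) (phi u / u)%:E =
   \sum_(j < n) \int[mu]_(u in `[1%R, q[) (phi (q ^+ j * u)%R / u)%:E)%E.
Proof.
move=> q1 mphi phi0; have q0 : 0 < q by rewrite (lt_trans _ q1).
have qn1 k : 1 <= q ^+ k by rewrite exprn_ege1// ltW.
elim: n => [|n IH]; first by rewrite expr0 set_itvco0 integral_set0 big_ord0.
rewrite big_ord_recr/= -IH.
have qq : q ^+ n <= q ^+ n.+1 by rewrite ler_weXn2l// ltW.
have -> : [set` `[1, (q ^+ n.+1)[] =
    [set` `[1, (q ^+ n)[] `|` [set` `[(q ^+ n * 1), (q ^+ n * q)[] :> set R.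
  rewrite mulr1 -exprSr; apply/seteqP; split => u /=; rewrite !in_itv/=.
    by move=> /andP[-> ->]; case: ltP; [left|right].
  by move=> [/andP[-> /lt_le_trans->//]|/andP[/(le_trans (qn1 n))-> ->]].
rewrite ge0_integral_setU//; last 3 first.
- apply: measurable_funS (measurable_haar mphi) => // u /=.
  rewrite !in_itv/= andbT => -[] /andP[+ _]; first exact: lt_le_trans.
  by apply: lt_le_trans; rewrite mulr1 exprn_gt0.
- move=> u /=; rewrite !in_itv/= lee_fin => -[] /andP[u1 _]; rewrite divr_ge0//.
    exact: le_trans u1.
  by rewrite (le_trans _ u1)// mulr_ge0// exprn_ge0// ltW.
- apply/disj_setPS => u [] /=; rewrite !in_itv/= mulr1 => /andP[_ +] /andP[+ _].
  by move=> /lt_le_trans h /h; rewrite ltxx.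
by rewrite integral_scale// exprn_gt0.
Qed.

End Circle.

(** * Square integrable functions on a circle and its covers *)

Section Covering.
Set Implicit Arguments.
Unset Strict Implicit.
Context {R : realType}.
Implicit Types (h : R -> R[i]).
Local Notation normc := ComplexField.Normc.normc.

(** Cauchy-Schwarz against the constant 1; the induction step expands the sum of
    the squares (a_j - b) ^ 2. *)
Lemma sqr_sum_le (n : nat) (a : 'I_n -> R) :
  (\sum_(j < n) a j) ^+ 2 <= n%:R * \sum_(j < n) a j ^+ 2.
Proof.
elim: n a => [|n IH] a; first by rewrite !big_ord0 expr0n mulr0.
rewrite !big_ord_recr/=; set b := a ord_max.
have := IH (fun j => a (widen_ord (leqnSn n) j)).
set S := \sum_(j < n) _; set T := \sum_(j < n) _ => ST.
have : 0 <= \sum_(j < n) (a (widen_ord (leqnSn n) j) - b) ^+ 2.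
  by apply: sumr_ge0 => j _; exact: sqr_ge0.
under eq_bigr do rewrite sqrrB.
rewrite big_split sumrB/= sumr_const card_ord sumrMnl -mulr_suml -/S -/T.
by rewrite -natr1 -[b ^+ 2 *+ n]mulr_natl; nra.
Qed.

Lemma normc_sum_sqr_le (n : nat) (z : 'I_n -> R[i]) :
  normc (\sum_(j < n) z j) ^+ 2 <= n%:R * \sum_(j < n) normc (z j) ^+ 2.
Proof.
have normc_ge0 (x : R[i]) : 0 <= normc x by case: x => ? ?; exact: sqrtr_ge0.
apply: (le_trans _ (sqr_sum_le (fun j => normc (z j)))).
rewrite ler_pXn2r ?nnegrE ?sumr_ge0//.
elim/big_ind2 : _ => [|z1 x1 z2 x2 H1 H2|//].
  by rewrite ComplexField.Normc.normc0.
by rewrite (le_trans (le_normcD _ _))// lerD.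
Qed.

Lemma normc_sqr (z : R[i]) : normc z ^+ 2 = complex.Re z ^+ 2 + complex.Im z ^+ 2.
Proof. by case: z => a b /=; rewrite sqr_sqrtr// addr_ge0// sqr_ge0. Qed.

Lemma measurable_normc_sqr (D : set R) h :
  measurable_fun D (fun u => complex.Re (h u)) ->
  measurable_fun D (fun u => complex.Im (h u)) ->
  measurable_fun D (fun u => normc (h u) ^+ 2).
Proof.
move=> mr mi; under eq_fun do rewrite normc_sqr.
by apply: measurable_funD; exact: measurable_funX.
Qed.

Lemma circle_sqnorm_cover (q : R) (n : nat) h : 1 < q ->
  measurable_fun (`]0, +oo[ : set R) (fun u => normc (h u) ^+ 2) ->
  circle_sqnorm (q ^+ n) h =
  (\sum_(j < n) circle_sqnorm q (fun u => h (q ^+ j * u)%R))%E.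
Proof.
move=> q1 mh; rewrite /circle_sqnorm.
by rewrite (integral_cover _ q1 mh)// => u; exact: sqr_ge0.
Qed.

(** Summation over the deck transformations, from the cover to the circle, is
    bounded with squared norm at most n. *)
Lemma circle_sqnorm_sum_le (q : R) (n : nat) h : 1 < q ->
  measurable_fun (`]0, +oo[ : set R) (fun u => complex.Re (h u)) ->
  measurable_fun (`]0, +oo[ : set R) (fun u => complex.Im (h u)) ->
  (circle_sqnorm q (fun u => \sum_(j < n) h (q ^+ j * u)%R)%R <=
   n%:R%:E * circle_sqnorm (q ^+ n) h)%E.
Proof.
move=> q1 mr mi.
have q0 : 0 < q by rewrite (lt_trans _ q1).
have sub : `[1, q[ `<=` (`]0, +oo[ : set R).
  by move=> u /=; rewrite !in_itv/= andbT => /andP[+ _]; exact: lt_le_trans.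
have pos (u : R) : `[1, q[%classic u -> 0 <= u.
  by move/sub; rewrite /= in_itv/= andbT => /ltW.
have mn : measurable_fun (`]0, +oo[ : set R) (fun u => normc (h u) ^+ 2).
  exact: measurable_normc_sqr.
have mj (j : nat) : measurable_fun (`[1, q[ : set R)
    (fun u => (normc (h (q ^+ j * u)) ^+ 2 / u)%:E).
  apply: measurable_funS sub _ => //; apply: measurable_haar.
  by apply: (measurable_fun_scale (phi := fun u => normc (h u) ^+ 2)) => //;
    exact: exprn_gt0.
rewrite circle_sqnorm_cover// /circle_sqnorm -ge0_integral_sum//; last 2 first.
- by move=> j; exact: mj.
- by move=> j u /pos u0; rewrite lee_fin divr_ge0 ?sqr_ge0.
rewrite -ge0_integralZl//; last 2 first.
- by apply: emeasurable_sum => j; exact: mj.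
- by move=> u /pos u0; apply: sume_ge0 => j _; rewrite lee_fin divr_ge0 ?sqr_ge0.
have mrsum : measurable_fun (`]0, +oo[ : set R)
    (fun u => complex.Re (\sum_(j < n) h (q ^+ j * u))).
  rewrite (_ : (fun u => _) =
      (fun u => \sum_(j < n) complex.Re (h (q ^+ j * u)))); last first.
    by apply/funext => u; exact: Re_sum.
  apply: measurable_sum => j.
  by apply: (measurable_fun_scale (phi := fun u => complex.Re (h u))) => //;
    exact: exprn_gt0.
have misum : measurable_fun (`]0, +oo[ : set R)
    (fun u => complex.Im (\sum_(j < n) h (q ^+ j * u))).
  rewrite (_ : (fun u => _) =
      (fun u => \sum_(j < n) complex.Im (h (q ^+ j * u)))); last first.
    by apply/funext => u; exact: Im_sum.
  apply: measurable_sum => j.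
  by apply: (measurable_fun_scale (phi := fun u => complex.Im (h u))) => //;
    exact: exprn_gt0.
apply: ge0_le_integral => //.
- by move=> u /pos u0; rewrite lee_fin divr_ge0 ?sqr_ge0.
- apply: measurable_funS sub _ => //; apply: measurable_haar.
  exact: measurable_normc_sqr.
- by apply: measurable_funeM; apply: emeasurable_sum => j; exact: mj.
- move=> u /pos u0; rewrite sumEFin -EFinM lee_fin -mulr_suml mulrA.
  by rewrite ler_wpM2r ?invr_ge0// normc_sum_sqr_le.
Qed.

Lemma circle_L2_expr (q : R) h (j : nat) (u : R) : 0 < q -> circle_L2 q h ->
  0 < u -> h (q ^+ j * u) = h u.
Proof.
move=> q0 [hq _ _ _]; elim: j u => [|j IH] u u0; first by rewrite expr0 mul1r.
by rewrite exprS -mulrA hq ?IH// mulr_gt0// exprn_gt0.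
Qed.

(** A function on the circle pulls back to the cover, where its squared norm is
    multiplied by n; the scalar is there because the approximation argument pulls
    back h / n. *)
Lemma circle_L2_pullback (q : R) (n : nat) (c : R) h : 1 < q ->
  `|c| <= 1 -> circle_L2 q h -> circle_L2 (q ^+ n) (fun u => c%:C%C * h u).
Proof.
move=> q1 c1 Lh; have [_ mr mi hfin] := Lh.
have q0 : 0 < q by rewrite (lt_trans _ q1).
have hqj (j : nat) u : 0 < u -> h (q ^+ j * u) = h u.
  exact: circle_L2_expr.
have ReZ (z : R[i]) : complex.Re (c%:C%C * z) = c * complex.Re z.
  by case: z => a b; simpc.
have ImZ (z : R[i]) : complex.Im (c%:C%C * z) = c * complex.Im z.
  by case: z => a b; simpc.
have mr' : measurable_fun (`]0, +oo[ : set R) (fun x => complex.Re (c%:C%C * h x)).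
  rewrite (_ : (fun u => _) = (fun u => c * complex.Re (h u))); last first.
    by apply/funext => u; rewrite ReZ.
  by apply: measurable_funM.
have mi' : measurable_fun (`]0, +oo[ : set R) (fun x => complex.Im (c%:C%C * h x)).
  rewrite (_ : (fun u => _) = (fun u => c * complex.Im (h u))); last first.
    by apply/funext => u; rewrite ImZ.
  by apply: measurable_funM.
split => //; first by move=> u u0; rewrite hqj.
rewrite circle_sqnorm_cover//; last exact: measurable_normc_sqr.
apply: lte_sum_pinfty => j _; apply: le_lt_trans hfin.
have sub : `[1, q[ `<=` (`]0, +oo[ : set R).
  by move=> u /=; rewrite !in_itv/= andbT => /andP[+ _]; exact: lt_le_trans.
have pos (u : R) : `[1, q[%classic u -> 0 < u.
  by move/sub; rewrite /= in_itv/= andbT.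
rewrite /circle_sqnorm; apply: ge0_le_integral => //.
- by move=> u /pos u0; rewrite lee_fin divr_ge0 ?sqr_ge0// ltW.
- apply: measurable_funS sub _ => //; apply: measurable_haar.
  apply: (measurable_fun_scale (phi := fun u => normc (c%:C%C * h u) ^+ 2)).
    exact: exprn_gt0.
  exact: measurable_normc_sqr.
- apply: measurable_funS sub _ => //; apply: measurable_haar.
  exact: measurable_normc_sqr.
- move=> u /pos u0; rewrite lee_fin hqj// ler_wpM2r ?invr_ge0 ?(ltW u0)//.
  rewrite !normc_sqr ReZ ImZ !exprMn -mulrDr ler_piMl ?addr_ge0 ?sqr_ge0//.
  by rewrite -real_normK ?num_real// exprn_ile1.
Qed.

(** The test function that approximates h / n on the cover serves for h on the
    circle: each fibre of the cover has n points, so summing the pullback of h / n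
    over a fibre gives back h. *)
Lemma dense_image_cover (q : R) (n : nat) : 1 < q -> (0 < n)%N ->
  dense_in_circle_L2 (q ^+ n) [set mapSigma (q ^+ n) (mapE f) | f in S0ev] ->
  dense_in_circle_L2 q [set mapSigma q (mapE f) | f in S0ev].
Proof.
move=> q1 n0 dn h Lh e e0.
have q0 : 0 < q by rewrite (lt_trans _ q1).
have qn1 : 1 < q ^+ n by rewrite exprn_egt1// -lt0n.
have n0' : 0 < n%:R :> R by rewrite ltr0n.
pose h1 u := (n%:R^-1)%:C%C * h u.
have Lh1 : circle_L2 (q ^+ n) h1.
  apply: circle_L2_pullback => //.
  by rewrite ger0_norm ?invr_ge0// invf_le1// ler1n.
(* The summation map costs a factor n on the squared norm, and
   n * (e / n) ^ 2 <= e ^ 2. *)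
have en0 : 0 < e / n%:R by rewrite divr_gt0.
have [_ [f Sf <-] fh1] := dn h1 Lh1 _ en0.
exists (mapSigma q (mapE f)); first by exists f.
pose d := mapSigma (q ^+ n) (mapE f) \- h1.
have [_ mr1 mi1 _] := Lh1.
have hqj (j : nat) u : 0 < u -> h (q ^+ j * u) = h u.
  exact: circle_L2_expr.
have mr : measurable_fun (`]0, +oo[ : set R) (fun u => complex.Re (d u)).
  rewrite (_ : (fun u => _) = (fun u =>
    realSigma (q ^+ n) (realE (fun x => complex.Re (f x))) u - complex.Re (h1 u))).
    apply: measurable_funB mr1; apply: measurable_funTS.
    exact: measurable_realSigma (S0ev_Re Sf) qn1.
  by apply/funext => u; rewrite /d/= mapSigma_complex//; case: (h1 u).
have mi : measurable_fun (`]0, +oo[ : set R) (fun u => complex.Im (d u)).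
  rewrite (_ : (fun u => _) = (fun u =>
    realSigma (q ^+ n) (realE (fun x => complex.Im (f x))) u - complex.Im (h1 u))).
    apply: measurable_funB mi1; apply: measurable_funTS.
    exact: measurable_realSigma (S0ev_Im Sf) qn1.
  by apply/funext => u; rewrite /d/= mapSigma_complex//; case: (h1 u).
have -> : circle_sqnorm q (mapSigma q (mapE f) \- h) =
    circle_sqnorm q (fun u => \sum_(j < n) d (q ^+ j * u)).
  apply: eq_integral => u /set_mem; rewrite /= in_itv/= => /andP[u1 _].
  have u0 : 0 < u by exact: lt_le_trans u1.
  rewrite -(mapSigma_cover u Sf q1 n0) /d/= sumrB.
  congr ((normc (_ - _) ^+ 2 / u)%:E).
  under eq_bigr do rewrite /h1 hqj//.
  rewrite sumr_const card_ord -[RHS]mulr_natl mulrA -(rmorph_nat (real_complex R)).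
  by rewrite -rmorphM/= divff ?gt_eqF// mul1r.
apply: (le_lt_trans (circle_sqnorm_sum_le n q1 mr mi)).
apply: (@lt_le_trans _ _ (n%:R%:E * ((e / n%:R) ^+ 2)%:E)%E).
  by rewrite lte_pmul2l// lte_fin.
rewrite -EFinM lee_fin expr_div_n mulrCA ler_piMr ?sqr_ge0//.
by rewrite expr2 invfM mulVKf ?gt_eqF// invf_le1// ler1n.
Qed.

End Covering.

Theorem proposition6p3 (R : realType) (mu : R) (n : nat) :
  (0 < n)%N -> zeta_cycle mu ->
  circle_length (mu ^+ n) = n%:R * circle_length mu /\ zeta_cycle (mu ^+ n).
Proof.
move=> n0 [mu1 ndense]; split; last split.
- by rewrite /circle_length lnXn ?(lt_trans _ mu1)// mulr_natl.
- by rewrite exprn_egt1// -lt0n.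
- by move=> dn; apply: ndense; exact: dense_image_cover dn.
Qed.
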